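(* Let $A\in\mathbb{H}^{m\times n}$ have rank $\nu$, and suppose $A=F_1G_1$ is an arbitrary full rank decomposition of $A$. Then $\mathcal{R}_r(A)=\mathcal{R}_r(F_1)$ and $\mathcal{N}_r(A)=\mathcal{N}_r(G_1)$.
   Context: $\mathbb{H}$ denotes the real quaternions. For $B\in\mathbb{H}^{m\times n}$, $\mathcal{R}_r(B)=\{Bx : x\in\mathbb{H}^{n\times 1}\}$ and $\mathcal{N}_r(B)=\{x\in\mathbb{H}^{n\times 1} : Bx=0\}$. The rank of $B$ is the maximal number of right linearly independent columns (equivalently, of left linearly independent rows). A full rank decomposition $A=F_1G_1$ of a rank-$\nu$ matrix $A\in\mathbb{H}^{m\times n}$ has $F_1\in\mathbb{H}^{m\times\nu}$, $G_1\in\mathbb{H}^{\nu\times n}$ and $\operatorname{rank}(F_1)=\operatorname{rank}(G_1)=\nu$. *)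

(* Defs.v *)
From HB Require Import structures.
From mathcomp Require Import all_boot all_order all_algebra.
From mathcomp Require Import ring.
From mathcomp Require Import boolp classical_sets reals.

Set Implicit Arguments.
Unset Strict Implicit.
Unset Printing Implicit Defensive.

Import GRing.Theory.

Local Open Scope ring_scope.

(* [Quaternion a b c d] is a + b i + c j + d k. *)
Record quaternion (R : Type) : Type :=
  Quaternion { qre : R; qi : R; qj : R; qk : R }.

Section QuaternionEqChoice.
Variable R : Type.

Definition tuple_of_quaternion (x : quaternion R) : R * R * R * R :=
  (qre x, qi x, qj x, qk x).

Definition quaternion_of_tuple (t : R * R * R * R) : quaternion R :=
  let: (a, b, c, d) := t in Quaternion a b c d.

Lemma tuple_of_quaternionK : cancel tuple_of_quaternion quaternion_of_tuple.
Proof. by case. Qed.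

End QuaternionEqChoice.

HB.instance Definition _ (R : eqType) := Equality.copy (quaternion R)
  (can_type (@tuple_of_quaternionK R)).
HB.instance Definition _ (R : choiceType) := Choice.copy (quaternion R)
  (can_type (@tuple_of_quaternionK R)).

Section QuaternionRing.
Variable R : realType.
Local Notation H := (quaternion R).

Definition quat0 : H := Quaternion 0 0 0 0.
Definition quat1 : H := Quaternion 1 0 0 0.

Definition addq (x y : H) : H :=
  let: Quaternion a b c d := x in
  let: Quaternion a' b' c' d' := y in
  Quaternion (a + a') (b + b') (c + c') (d + d').

Definition oppq (x : H) : H :=
  let: Quaternion a b c d := x in Quaternion (- a) (- b) (- c) (- d).

Definition mulq (x y : H) : H :=
  let: Quaternion a b c d := x in
  let: Quaternion a' b' c' d' := y in
  Quaternion (a * a' - b * b' - c * c' - d * d')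
             (a * b' + b * a' + c * d' - d * c')
             (a * c' - b * d' + c * a' + d * b')
             (a * d' + b * c' - c * b' + d * a').

Lemma addqA : associative addq.
Proof. by move=> [a b c d] [? ? ? ?] [? ? ? ?] /=; rewrite !addrA. Qed.

Lemma addqC : commutative addq.
Proof. by move=> [a b c d] [? ? ? ?] /=; congr Quaternion; ring. Qed.

Lemma add0q : left_id quat0 addq.
Proof. by move=> [a b c d] /=; rewrite !add0r. Qed.

Lemma addNq : left_inverse quat0 oppq addq.
Proof. by move=> [a b c d] /=; rewrite !addNr. Qed.

HB.instance Definition _ :=
  GRing.isZmodule.Build H addqA addqC add0q addNq.

Lemma mulqA : associative mulq.
Proof. by move=> [a b c d] [? ? ? ?] [? ? ? ?] /=; congr Quaternion; ring. Qed.

Lemma mul1q : left_id quat1 mulq.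
Proof. by move=> [a b c d] /=; congr Quaternion; ring. Qed.

Lemma mulq1 : right_id quat1 mulq.
Proof. by move=> [a b c d] /=; congr Quaternion; ring. Qed.

Lemma mulqDl : left_distributive mulq +%R.
Proof. by move=> [a b c d] [? ? ? ?] [? ? ? ?] /=; congr Quaternion; ring. Qed.

Lemma mulqDr : right_distributive mulq +%R.
Proof. by move=> [a b c d] [? ? ? ?] [? ? ? ?] /=; congr Quaternion; ring. Qed.

Lemma quat1_neq0 : quat1 != 0.
Proof. by apply/eqP => -[] /eqP; rewrite oner_eq0. Qed.

HB.instance Definition _ :=
  GRing.Zmodule_isNzRing.Build H mulqA mul1q mulq1 mulqDl mulqDr quat1_neq0.

Lemma quaternion_relations :
  let i : H := Quaternion 0 1 0 0 in
  let j : H := Quaternion 0 0 1 0 in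
  let k : H := Quaternion 0 0 0 1 in
  [/\ i * i = -1, j * j = -1, k * k = -1 & i * j * k = -1].
Proof. by split; congr Quaternion => /=; ring. Qed.

End QuaternionRing.

Section QuaternionMatrices.
Variable R : realType.
Local Notation H := (quaternion R).
Local Open Scope classical_set_scope.

Definition right_range m n (B : 'M[H]_(m, n)) : set 'cV[H]_m :=
  [set B *m x | x in [set: 'cV[H]_n]].

Definition right_null m n (B : 'M[H]_(m, n)) : set 'cV[H]_n :=
  [set x | B *m x = 0].

(* The scalar [c j] multiplies the [j]-th column on the right, which
   [*:] (left scaling) cannot express over a noncommutative ring. *)
Definition right_indep_cols m n (B : 'M[H]_(m, n)) (S : {set 'I_n}) : Prop :=
  forall c : 'I_n -> H,
    (forall i : 'I_m, \sum_(j in S) B i j * c j = 0) ->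
    forall j, j \in S -> c j = 0.

Definition quat_rank m n (B : 'M[H]_(m, n)) : nat :=
  \max_(S : {set 'I_n} | `[< right_indep_cols B S >]) #|S|.

Definition full_rank_decomposition m n nu (A : 'M[H]_(m, n))
    (F : 'M[H]_(m, nu)) (G : 'M[H]_(nu, n)) : Prop :=
  [/\ A = F *m G, quat_rank F = nu & quat_rank G = nu].

End QuaternionMatrices.

(* Main.v *)
(** Independence of all the columns of [F1] makes [x |-> F1 x] injective, which
    gives the equality of null spaces.  For the ranges, [G1] has [nu] independent
    columns in [H^nu]; adjoining any [y] to them gives a matrix with more columns
    than rows, hence a nontrivial relation, in which the coefficient of [y] is
    nonzero and can be inverted.  So [G1] is surjective. *)
Require Import Defs.
From mathcomp Require Import all_boot all_order all_algebra.
From mathcomp Require Import boolp classical_sets reals.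
From mathcomp Require Import ring.

Set Implicit Arguments.
Unset Strict Implicit.
Unset Printing Implicit Defensive.

Import GRing.Theory Num.Theory.

Local Open Scope ring_scope.

(** Gaussian elimination, by induction on the number of rows. Unknowns multiply on the right of the
    entries, so right inverses suffice to solve for a pivot variable. *)
Lemma wide_mx_null (D : nzRingType)
    (Dinv : forall x : D, x != 0 -> exists y, x * y = 1) m n (B : 'M[D]_(m, n)) :
  (m < n)%N -> exists2 x : 'cV[D]_n, x != 0 & B *m x = 0.
Proof.
elim: m n B => [|m IHm] [|n] // B lt_mn.
  exists (const_mx 1); last by apply/matrixP => -[].
  by apply/eqP => /matrixP/(_ 0 0)/eqP; rewrite !mxE oner_eq0.
have [row0|[j Bj]] : (forall j, B 0 j = 0) \/ exists j, B 0 j != 0.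
- case: (pickP (fun j => B 0 j != 0)) => [j Bj|B0]; first by right; exists j.
  by left=> j; apply/eqP/negbFE/B0.
- have [x x0 Bx] := IHm _ (row' 0 B) (ltnW lt_mn).
  exists x => //; apply/matrixP => i k; rewrite ord1 !mxE.
  case: (unliftP 0 i) => [i' ->|->]; last by rewrite big1 // => l _; rewrite row0 mul0r.
  have /matrixP/(_ i' 0) := Bx; rewrite !mxE => E; rewrite -[RHS]E.
  by apply: eq_bigr => l _; rewrite mxE.
- have [v Bv] := Dinv _ Bj.
  (* Schur complement of the pivot [B 0 j]: row 0 and column [j] are eliminated. *)
  pose C := \matrix_(i < m, k < n)
    (B (lift 0 i) (lift j k) - B (lift 0 i) j * v * B 0 (lift j k)).
  have [z z0 Cz] := IHm _ C lt_mn.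
  pose s := \sum_k B 0 (lift j k) * z k 0.
  (* The entry at [j] solves row 0, since [B 0 j * v = 1]; the other rows then reduce to
     [C *m z = 0]. *)
  pose x := \col_a (if unlift j a is Some k then z k 0 else - (v * s)).
  have xE i : (B *m x) i 0 = \sum_k B i (lift j k) * z k 0 - B i j * v * s.
    rewrite mxE (bigD1_ord j) //= mxE unlift_none mulrN mulrA addrC; congr (_ + _).
    by apply: eq_bigr => k _; rewrite mxE liftK.
  exists x.
    apply: contraNneq z0 => x0; apply/eqP/matrixP => k l.
    by have /matrixP/(_ (lift j k) 0) := x0; rewrite !mxE liftK (ord1 l).
  apply/matrixP => i l; rewrite ord1 xE mxE.
  case: (unliftP 0 i) => [i' ->|->]; last by rewrite Bv mul1r subrr.
  have /matrixP/(_ i' 0) := Cz; rewrite !mxE => E; rewrite -[RHS]E.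
  rewrite mulr_sumr -sumrB; apply: eq_bigr => k _.
  by rewrite mxE mulrBl mulrA.
Qed.

Lemma injective_mx_surj (D : nzRingType)
    (Dinv : forall x : D, x != 0 -> exists y, x * y = 1) m n (B : 'M[D]_(m, n)) :
    (m <= n)%N -> (forall x : 'cV_n, B *m x = 0 -> x = 0) ->
  forall y : 'cV_m, exists x, B *m x = y.
Proof.
move=> le_mn Binj y.
have lt_mn : (m < n + 1)%N by rewrite addn1.
have [z z0] := wide_mx_null Dinv (row_mx B y) lt_mn.
rewrite -(vsubmxK z) in z0 *; set x := usubmx z; set c := dsubmx z in z0 *.
rewrite mul_row_col => /eqP; rewrite addrC addr_eq0 => /eqP yc.
have [c0|/Dinv [d cd]] := eqVneq (c 0 0) 0.
  (* If the coefficient of [y] vanishes, injectivity kills [x] too, against [z != 0]. *)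
  have c0' : c = 0 by apply/matrixP => i j; rewrite !ord1 c0 mxE.
  move: yc; rewrite c0' mulmx0 => /esym/eqP; rewrite oppr_eq0 => /eqP/Binj x0.
  by rewrite -/x c0' x0 col_mx0 eqxx in z0.
exists (- x *m d%:M); rewrite mulmxA mulmxN -yc -mulmxA.
by rewrite [c]mx11_scalar -scalar_mxM cd mulmx1.
Qed.

Section Quaternion.
Variable R : realType.
Local Notation H := (quaternion R).

(** The inverse is the conjugate over the squared norm [N], a sum of squares that vanishes only at
    zero. *)
Lemma quaternion_rinv (x : H) : x != 0 -> exists y, x * y = 1.
Proof.
case: x => a b c d x0.
pose N := a ^+ 2 + b ^+ 2 + c ^+ 2 + d ^+ 2.
have N0 : N != 0.
  apply: contra x0; rewrite /N !paddr_eq0 ?addr_ge0 ?sqr_ge0 // !sqrf_eq0.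
  by move=> /andP[/andP[/andP[/eqP-> /eqP->] /eqP->] /eqP->].
exists (Quaternion (a / N) (- b / N) (- c / N) (- d / N)).
by congr Quaternion; rewrite /N; field.
Qed.

(** The empty set of columns is independent, so the maximum runs over a nonempty family and is
    attained. *)
Lemma quat_rank_witness m n (B : 'M[H]_(m, n)) :
  exists2 S, right_indep_cols B S & #|S| = quat_rank B.
Proof.
have indep0 : `[< right_indep_cols B finset.set0 >].
  by apply/asboolP => c _ j; rewrite finset.in_set0.
rewrite /quat_rank (bigop.bigmax_eq_arg finset.set0 indep0).
case: (@arg_maxnP _ _ (fun S => `[< right_indep_cols B S >]) _ indep0).
by move=> S /asboolP ? _; exists S.
Qed.

Lemma right_indep_cols_inj m n (B : 'M[H]_(m, n)) (S : {set 'I_n}) (x : 'cV_#|S|) :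
  right_indep_cols B S -> colsub enum_val B *m x = 0 -> x = 0.
Proof.
(* [c] extends [x] by zero outside [S]: the sum has one term for [j] in [S] and is empty
   otherwise. *)
move=> Sindep Bx; pose c j := \sum_(k | enum_val k == j :> 'I_n) x k 0.
have cE k : c (enum_val k) = x k 0.
  by rewrite /c (big_pred1 k) // => l; rewrite (inj_eq enum_val_inj).
apply/matrixP => k l; rewrite ord1 mxE -cE; apply: Sindep; last exact: enum_valP.
move=> i; have /matrixP/(_ i 0) := Bx; rewrite !mxE => E; rewrite -[RHS]E.
by rewrite [LHS]big_enum_val; apply: eq_bigr => h _; rewrite mxE cE.
Qed.

Lemma full_col_rank_inj m n (B : 'M[H]_(m, n)) (x : 'cV_n) :
  quat_rank B = n -> B *m x = 0 -> x = 0.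
Proof.
move=> rankB Bx; have [S Sindep cardS] := quat_rank_witness B.
have ST : S = [set: 'I_n]%SET.
  by apply/eqP; rewrite eqEcard finset.subsetT cardsT card_ord cardS rankB /=.
apply/matrixP => j k; rewrite ord1 mxE.
apply: (Sindep (x^~ 0)); last by rewrite ST finset.in_setT.
move=> i; have /matrixP/(_ i 0) := Bx; rewrite !mxE => E; rewrite -[RHS]E ST.
by apply: eq_bigl => l; rewrite finset.in_setT.
Qed.

Lemma full_row_rank_surj m n (B : 'M[H]_(m, n)) (y : 'cV_m) :
  quat_rank B = m -> exists x, B *m x = y.
Proof.
move=> rankB; have [S Sindep cardS] := quat_rank_witness B.
have le_mS : (m <= #|S|)%N by rewrite cardS rankB.
have [x <-] := injective_mx_surj quaternion_rinv le_mS
  (fun x => right_indep_cols_inj Sindep) y.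
(* Multiplying by these columns of the identity pads [x] with zeros outside [S]. *)
exists (colsub enum_val 1%:M *m x); rewrite mulmxA.
by rewrite mulmx_colsub mulmx1.
Qed.

End Quaternion.

Theorem theorem4p9 (R : realType) (m n nu : nat)
  (A : 'M[quaternion R]_(m, n))
  (F1 : 'M[quaternion R]_(m, nu)) (G1 : 'M[quaternion R]_(nu, n))
  (rankA : quat_rank A = nu)
  (decA : full_rank_decomposition A F1 G1) :
  right_range A = right_range F1 /\ right_null A = right_null G1.
Proof.
case: decA => -> rankF rankG; split; apply/seteqP; split=> x /=.
- by case=> y _ <-; exists (G1 *m y); rewrite ?mulmxA.
(* Lifting [y] through [G1] turns a value of [F1] into a value of the product. *)
- case=> y _ <-; have [z <-] := full_row_rank_surj y rankG.
  by exists z; rewrite ?mulmxA.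
- by rewrite /right_null /= -mulmxA; apply: full_col_rank_inj.
- by rewrite /right_null /= -mulmxA => ->; rewrite mulmx0.
Qed.
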